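(* Let $n,m,\bar h,T$ be positive integers with $T>\bar h$, and let $h_1,h_2\in\mathbb{Z}_{\ge 0}$ with $h_1\le\bar h$ and $h_2\le\bar h$ be known constant delays. Consider the linear discrete-time time-delay system $$x(k+1)=\begin{bmatrix}B & A_1 & A_0\end{bmatrix}\begin{bmatrix}u(k-h_2)\\ x(k-h_1)\\ x(k)\end{bmatrix},\qquad k\in\mathbb{Z}_{\ge 0},\qquad(\ast)$$ with state $x(k)\in\mathbb{R}^n$, input $u(k)\in\mathbb{R}^m$, and constant but unknown matrices $A_0,A_1\in\mathbb{R}^{n\times n}$, $B\in\mathbb{R}^{n\times m}$. Let input and state data $u(-\bar h),\dots,u(T)$ and $x(-\bar h),\dots,x(T)$ recorded from $(\ast)$ be available, and let $X_{\{1\}}\in\mathbb{R}^{n\times T}$ and $W_0\in\mathbb{R}^{(m+2n)\times T}$ be the data matrices defined in the context. Then the system trajectories of $(\ast)$ and those of the system $$x(k+1)=X_{\{1\}}W_0^{\dagger}\begin{bmatrix}u(k-h_2)\\ x(k-h_1)\\ x(k)\end{bmatrix}$$ are equivalent if and only if $\mathrm{rank}(W_0)=m+2n$. Furthermore, under this rank condition, it holds that $\begin{bmatrix}B & A_1 & A_0\end{bmatrix}=X_{\{1\}}W_0^{\dagger}$.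
   Context: Data matrices: $U_{h_2,\{0\}}=[u(-h_2)\ u(1-h_2)\ \cdots\ u(T-1-h_2)]\in\mathbb{R}^{m\times T}$, $X_{h_1,\{0\}}=[x(-h_1)\ x(1-h_1)\ \cdots\ x(T-1-h_1)]\in\mathbb{R}^{n\times T}$, $X_{\{0\}}=[x(0)\ x(1)\ \cdots\ x(T-1)]\in\mathbb{R}^{n\times T}$, $X_{\{1\}}=[x(1)\ x(2)\ \cdots\ x(T)]\in\mathbb{R}^{n\times T}$, and $$W_0=\begin{bmatrix}U_{h_2,\{0\}}\\ X_{h_1,\{0\}}\\ X_{\{0\}}\end{bmatrix}\in\mathbb{R}^{(m+2n)\times T}.$$ $W_0^\dagger$ denotes the Moore-Penrose inverse of $W_0$; if $W_0$ has full row rank, $W_0^\dagger=W_0^\top(W_0W_0^\top)^{-1}$ and $W_0W_0^\dagger=I_{m+2n}$. The recorded data are noise-free and satisfy $(\ast)$ for $k=0,\dots,T-1$, with the delays constant during the recording, so that $X_{\{1\}}=[B\ A_1\ A_0]W_0$. The initial condition and past inputs of the system are $x(j)=\phi_j\in\mathbb{R}^n$ and $u(j)=0$ for $j\in\mathbb{Z}\cap[-\bar h,0]$. Trajectories of the two systems are equivalent when, from the same initial conditions and under the same inputs, the two systems generate the same state sequence.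
   Formalization: Equivalence is required for every system matrix [B A1 A0] consistent with the recorded data, not only the true one (zero data refute ''only if'' for a fixed system), and the equivalence is stated for h1 ≥ 1, since ''only if'' fails at h1 = 0; the final identity covers all h1. *)

(* Defs.v *)
From mathcomp Require Import all_boot all_order all_algebra.
From mathcomp Require Import reals.

Set Implicit Arguments.
Unset Strict Implicit.
Unset Printing Implicit Defensive.

Import Order.TTheory GRing.Theory Num.Theory.
Local Open Scope ring_scope.

(* Real Moore-Penrose inverse, by full rank factorization: if A = C F with C of
   full column rank and F of full row rank, the pseudoinverse of A is
   F^T (F F^T)^-1 (C^T C)^-1 C^T.  See mpinvP and mpinv_unique for the defining
   Penrose equations, and mpinv_row_free for the full row rank case. *)
Definition mpinv (R : realFieldType) (p q : nat) (A : 'M[R]_(p, q)) :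
    'M[R]_(q, p) :=
  let C := col_base A in
  let F := row_base A in
  F^T *m invmx (F *m F^T) *m (invmx (C^T *m C) *m C^T).

Definition penrose (R : realFieldType) (p q : nat)
    (A : 'M[R]_(p, q)) (P : 'M[R]_(q, p)) : Prop :=
  [/\ A *m P *m A = A, P *m A *m P = P,
      (A *m P)^T = A *m P & (P *m A)^T = P *m A].

Lemma gram_unitmx (R : realFieldType) (p q : nat) (F : 'M[R]_(p, q)) :
  row_free F -> F *m F^T \in unitmx.
Proof.
move=> freeF; rewrite -row_free_unit; apply: inj_row_free => v vG0.
have w0 : v *m F = 0.
  have : (v *m F) *m (v *m F)^T = 0.
    by rewrite trmx_mul mulmxA -(mulmxA v) vG0 mul0mx.
  move=> /matrixP /(_ ord0 ord0); rewrite !mxE => /eqP.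
  rewrite psumr_eq0; last by move=> i _; rewrite !mxE -expr2 sqr_ge0.
  move=> /allP w0; apply/rowP => j; rewrite [RHS]mxE.
  have := w0 j (mem_index_enum _); rewrite !mxE /= mulf_eq0 orbb.
  by move=> /eqP.
by apply: (row_free_inj freeF); rewrite w0 mul0mx.
Qed.

Lemma penrose_factor (R : realFieldType) (p q r : nat)
    (C : 'M[R]_(p, r)) (F : 'M[R]_(r, q)) :
  C^T *m C \in unitmx -> F *m F^T \in unitmx ->
  penrose (C *m F)
    (F^T *m invmx (F *m F^T) *m (invmx (C^T *m C) *m C^T)).
Proof.
move=> uC uF.
have : (invmx (F *m F^T))^T = invmx (F *m F^T).
  by rewrite trmx_inv trmx_mul trmxK.
have : (invmx (C^T *m C))^T = invmx (C^T *m C).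
  by rewrite trmx_inv trmx_mul trmxK.
have := mulVmx uC; have := mulmxV uF.
move: (invmx (F *m F^T)) (invmx (C^T *m C)) => G H FG HC HT GT.
have CP : C *m F *m (F^T *m G *m (H *m C^T)) = C *m H *m C^T.
  by rewrite !mulmxA -(mulmxA C) -(mulmxA C) FG mulmx1.
have PC : F^T *m G *m (H *m C^T) *m (C *m F) = F^T *m G *m F.
  by rewrite -!mulmxA (mulmxA C^T) (mulmxA H) HC mul1mx.
split.
- by rewrite CP -!mulmxA (mulmxA C^T) (mulmxA H) HC mul1mx.
- by rewrite PC !mulmxA -(mulmxA _ F) -(mulmxA _ (F *m F^T)) FG mulmx1.
- by rewrite CP !trmx_mul trmxK HT mulmxA.
- by rewrite PC !trmx_mul trmxK GT mulmxA.
Qed.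

Lemma mpinvP (R : realFieldType) (p q : nat) (A : 'M[R]_(p, q)) :
  penrose A (mpinv A).
Proof.
rewrite -{1}(mulmx_base A); apply: penrose_factor.
- rewrite -{2}[col_base A]trmxK; apply: gram_unitmx.
  by rewrite /row_free mxrank_tr; exact: col_base_full.
- by apply: gram_unitmx; exact: row_base_free.
Qed.

Lemma mpinv_unique (R : realFieldType) (p q : nat)
    (A : 'M[R]_(p, q)) (P : 'M[R]_(q, p)) :
  penrose A P -> P = mpinv A.
Proof.
move: (mpinvP A); set Q := mpinv A => -[q1 q2 q3 q4] [p1 p2 p3 p4].
have eqA : A *m P = A *m Q.
  rewrite -[LHS]p3 -{1}q1 -(mulmxA (A *m Q)) trmx_mul p3 q3 mulmxA p1.
  by [].
have eqB : P *m A = Q *m A.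
  rewrite -[LHS]p4 -{1}q1 -mulmxA mulmxA trmx_mul q4 p4.
  by rewrite -mulmxA (mulmxA A) p1.
by rewrite -p2 eqB -mulmxA eqA mulmxA q2.
Qed.

Lemma mpinv_row_free (R : realFieldType) (p q : nat) (A : 'M[R]_(p, q)) :
  row_free A -> mpinv A = A^T *m invmx (A *m A^T).
Proof.
move=> freeA; have uA := gram_unitmx freeA; symmetry; apply: mpinv_unique.
have AK : A *m (A^T *m invmx (A *m A^T)) = 1%:M by rewrite mulmxA mulmxV.
split; rewrite ?AK ?mul1mx ?trmx1 // -?mulmxA ?AK ?mulmx1 //.
by rewrite !trmx_mul trmx_inv !trmx_mul !trmxK mulmxA.
Qed.

Section TimeDelay.

Variables (R : realType) (n m : nat).

(* Signals are indexed by int so that the past samples have negative times. *)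
Implicit Types (u : int -> 'cV[R]_m) (x phi : int -> 'cV[R]_n).
Implicit Types M : 'M[R]_(n, m + (n + n)).

(* [ s(t)  s(t+1)  ...  s(t+T-1) ] *)
Definition data_window (p : nat) (s : int -> 'cV[R]_p) (t : int) (T : nat) :
    'M[R]_(p, T) :=
  \matrix_(i < p, j < T) s (t + (j : nat)%:Z) i 0.

Definition data_X1 (T : nat) x : 'M[R]_(n, T) := data_window x 1 T.

Definition data_W0 (h1 h2 T : nat) u x : 'M[R]_(m + (n + n), T) :=
  col_mx (data_window u (- h2%:Z) T)
    (col_mx (data_window x (- h1%:Z) T) (data_window x 0 T)).

Definition sys_mx (B : 'M[R]_(n, m)) (A1 A0 : 'M[R]_n) :
    'M[R]_(n, m + (n + n)) :=
  row_mx B (row_mx A1 A0).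

Definition regressor (h1 h2 : nat) u x (k : nat) : 'cV[R]_(m + (n + n)) :=
  col_mx (u (k%:Z - h2%:Z)) (col_mx (x (k%:Z - h1%:Z)) (x k%:Z)).

Definition steps (h1 h2 : nat) M u x (k : nat) : Prop :=
  x (k%:Z + 1) = M *m regressor h1 h2 u x k.

Definition recorded (h1 h2 T : nat) M u x : Prop :=
  forall k : nat, (k < T)%N -> steps h1 h2 M u x k.

(* From the initial condition phi on [-hbar, 0], and under the input u, the
   system with matrix M generates the state sequence x. *)
Definition generates (hbar h1 h2 : nat) M phi u x : Prop :=
  (forall j : int, - hbar%:Z <= j <= 0 -> x j = phi j) /\
  (forall k : nat, steps h1 h2 M u x k).

Definition zero_past (hbar : nat) u : Prop :=
  forall j : int, - hbar%:Z <= j <= 0 -> u j = 0.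

(* Values of x at times below -hbar are unconstrained; no system with delays at
   most hbar reads them. *)
Definition equivalent_trajectories (hbar h1 h2 : nat) M1 M2 : Prop :=
  forall phi u, zero_past hbar u ->
  forall x, generates hbar h1 h2 M1 phi u x <-> generates hbar h1 h2 M2 phi u x.

End TimeDelay.

(* Main.v *)
(* A matrix M is consistent with the data iff X1 = M W0.  If W0 has full row
   rank, then W0 W0^+ = 1 and M = X1 W0^+.  Otherwise some v <> 0 satisfies
   v W0 = 0, so M + c v is consistent for every column c; but equivalent systems
   have the same matrix, so that M and M + c v would both be X1 W0^+.  Equivalent
   systems have the same matrix because the free initial values x(-h1) and x(0)
   reveal [A1 A0] in x(1), and an input pulse at time 1 from zero initial
   values reveals B in x(h2 + 2). *)
Require Import Defs.
From mathcomp Require Import all_boot all_order all_algebra.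
From mathcomp Require Import reals.
From mathcomp Require Import zify.

Set Implicit Arguments.
Unset Strict Implicit.
Unset Printing Implicit Defensive.

Import Order.TTheory GRing.Theory Num.Theory.
Local Open Scope ring_scope.

Lemma mulmx_col_inj (R : pzRingType) (p q : nat) (M1 M2 : 'M[R]_(p, q)) :
  (forall v : 'cV_q, M1 *m v = M2 *m v) -> M1 = M2.
Proof.
by move=> eqM; apply/trmx_inj/row_matrixP => i; rewrite -!tr_col !colE eqM.
Qed.

Section Trajectory.

Variables (R : realType) (n m h1 h2 : nat) (M : 'M[R]_(n, m + (n + n))).
Variables (phi : int -> 'cV[R]_n) (u : int -> 'cV[R]_m).

(* The signal known up to time k; later values are those of phi. *)
Fixpoint history (k : nat) : int -> 'cV[R]_n :=
  if k is k'.+1 then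
    fun j => if j == k'.+1%:Z then M *m regressor h1 h2 u (history k') k'
             else history k' j
  else phi.

(** For [j > 0], stage [j] is the first to contain the sample at time [j]; for [j <= 0] every stage
    returns [phi j], so the absolute value does no harm. *)
Definition trajectory (j : int) : 'cV[R]_n := history `|j|%N j.

Lemma history_stable (k l : nat) (j : int) :
  j <= k%:Z -> (k <= l)%N -> history l j = history k j.
Proof.
move=> jk; elim: l => [|l IHl]; first by rewrite leqn0 => /eqP ->.
rewrite leq_eqVlt => /predU1P[-> //|kl] /=.
by rewrite ifN ?IHl //; apply/eqP; lia.
Qed.

Lemma history_neg (k : nat) (j : int) : j <= 0 -> history k j = phi j.
Proof. by move=> j0; rewrite (@history_stable 0 k). Qed.

Lemma historyE (k : nat) (j : int) : j <= k%:Z -> history k j = trajectory j.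
Proof.
move=> jk; have [j0|j0] := leP j 0; first by rewrite /trajectory !history_neg.
by rewrite /trajectory (@history_stable `|j|%N k) //; lia.
Qed.

Lemma trajectory_generates (hbar : nat) :
  generates hbar h1 h2 M phi u trajectory.
Proof.
split=> [j /andP[_ j0]|k]; first by rewrite /trajectory history_neg.
rewrite /steps -(@historyE k.+1) /=; last by lia.
by rewrite ifT; [rewrite /regressor !historyE //; lia | apply/eqP; lia].
Qed.

End Trajectory.

Section Identification.

Variables (R : realType) (n m hbar h1 h2 : nat).
Hypothesis h1_le : (h1 <= hbar)%N.
Implicit Types M : 'M[R]_(n, m + (n + n)).

(** Induction on time: since [h1 <= hbar], step [k <= N] reads only states already shown to vanish
    and the input at [k - h2], which is zero. *)
Lemma zero_response M u x (N : nat) :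
  (forall j : int, j <= N%:Z - h2%:Z -> u j = 0) ->
  generates hbar h1 h2 M (fun=> 0) u x ->
  forall j : int, - hbar%:Z <= j <= N.+1%:Z -> x j = 0.
Proof.
move=> u0 [x0 xS].
suff x0N k : (k <= N.+1)%N -> forall j : int, - hbar%:Z <= j <= k%:Z -> x j = 0.
  exact: x0N.
elim: k => [_ j|k IHk kN j jk]; first exact: x0.
have [jk'|] := leP j k%:Z; first by apply: IHk; lia.
move=> jk'; have -> : j = k%:Z + 1 by lia.
rewrite xS /regressor u0; last by lia.
by rewrite !IHk ?col_mx0 ?mulmx0 //; lia.
Qed.

(** The input at time 1 is read at step [h2 + 1], when the current and delayed states are still
    zero, so only the input block of [M] acts. *)
Lemma pulse_response M u x :
  (forall j : int, j <= 0 -> u j = 0) ->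
  generates hbar h1 h2 M (fun=> 0) u x ->
  x (h2.+1%:Z + 1) = M *m col_mx (u 1) 0.
Proof.
move=> u0 gx.
have x0 : forall j : int, - hbar%:Z <= j <= h2.+1%:Z -> x j = 0.
  by apply: zero_response gx => j j0; apply: u0; lia.
case: gx => _ ->; rewrite /regressor !x0; try lia.
by rewrite col_mx0; congr (_ *m col_mx (u _) _); lia.
Qed.

Lemma free_response M phi x :
  generates hbar h1 h2 M phi (fun=> 0) x ->
  x 1 = M *m col_mx 0 (col_mx (phi (- h1%:Z)) (phi 0)).
Proof.
case=> x0 /(_ 0%N); rewrite /steps /regressor add0r => ->.
by rewrite sub0r !x0 //; lia.
Qed.

Lemma equivalent_trajectories_inj M1 M2 :
  (0 < h1)%N -> equivalent_trajectories hbar h1 h2 M1 M2 -> M1 = M2.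
Proof.
move=> h1_gt0 eqM; apply: mulmx_col_inj => v; rewrite -[v]vsubmxK.
move: (usubmx v) (dsubmx v) => a w; rewrite -[w]vsubmxK.
move: (usubmx w) (dsubmx w) => b c {v w}.
have -> : col_mx a (col_mx b c) = col_mx a 0 + col_mx 0 (col_mx b c).
  by rewrite add_col_mx addr0 add0r.
rewrite !mulmxDr; congr (_ + _).
(* [zero_past] forces the input to vanish at time 0, so the pulse is put at time 1. *)
- pose u (j : int) := if j == 1 then a else 0.
  have u0 j : j <= 0 -> u j = 0 by rewrite /u; case: eqP => //; lia.
  have zu : zero_past hbar u by move=> j /andP[_]; exact: u0.
  have g1 := trajectory_generates h1 h2 M1 (fun=> 0) u hbar.
  have /(pulse_response u0) := g1.
  by rewrite (pulse_response u0 ((eqM _ _ zu _).1 g1)) /u eqxx.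
(* Since [0 < h1], the times [- h1] and 0 differ, so [b] and [c] are prescribed independently; for
   [h1 = 0] only the sum of the two state blocks would show. *)
- pose phi (j : int) := if j == 0 then c else b.
  have zu : zero_past hbar (fun=> 0 : 'cV[R]_m) by [].
  have g1 := trajectory_generates h1 h2 M1 phi (fun=> 0) hbar.
  have /free_response := g1.
  rewrite (free_response ((eqM _ _ zu _).1 g1)) /phi eqxx ifN //.
  by apply/eqP; lia.
Qed.

End Identification.

(** Column [j] of the matrix equation is step [j] of the system. *)
Lemma recordedP (R : realType) (n m h1 h2 T : nat) (M : 'M[R]_(n, m + (n + n)))
    (u : int -> 'cV[R]_m) (x : int -> 'cV[R]_n) :
  recorded h1 h2 T M u x <-> data_X1 T x = M *m data_W0 h1 h2 T u x.
Proof.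
have colX1 (j : 'I_T) : col j (data_X1 T x) = x ((j : nat)%:Z + 1).
  by apply/colP => i; rewrite !mxE addrC.
have colW0 (j : 'I_T) : col j (data_W0 h1 h2 T u x) = regressor h1 h2 u x j.
  rewrite /data_W0 /regressor !col_col_mx.
  by congr (col_mx _ (col_mx _ _)); apply/colP => i;
    rewrite !mxE ?add0r // addrC.
have colMW (j : 'I_T) :
    col j (M *m data_W0 h1 h2 T u x) = M *m regressor h1 h2 u x j.
  by rewrite colE -mulmxA -colE colW0.
split=> [rec|eqX k kT].
  apply/trmx_inj/row_matrixP => j; rewrite -!tr_col colMW colX1.
  by rewrite (rec j).
by rewrite /steps -(colX1 (Ordinal kT)) eqX colMW.
Qed.

Lemma mulmx_mpinv (R : realFieldType) (p q : nat) (A : 'M[R]_(p, q)) :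
  row_free A -> A *m mpinv A = 1%:M.
Proof.
by move=> fA; rewrite mpinv_row_free // mulmxA mulmxV // gram_unitmx.
Qed.

Theorem proposition3p1 (R : realType) (n m hbar T h1 h2 : nat)
    (n_gt0 : (0 < n)%N) (m_gt0 : (0 < m)%N) (hbar_gt0 : (0 < hbar)%N)
    (hbar_ltT : (hbar < T)%N) (h1_le : (h1 <= hbar)%N) (h2_le : (h2 <= hbar)%N)
    (B : 'M[R]_(n, m)) (A1 A0 : 'M[R]_n)
    (u : int -> 'cV[R]_m) (x : int -> 'cV[R]_n)
    (data_ux : recorded h1 h2 T (sys_mx B A1 A0) u x) :
  let X1 := data_X1 T x in
  let W0 := data_W0 h1 h2 T u x in
  ((0 < h1)%N ->
     ((forall (B' : 'M[R]_(n, m)) (A1' A0' : 'M[R]_n),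
         recorded h1 h2 T (sys_mx B' A1' A0') u x ->
         equivalent_trajectories hbar h1 h2 (sys_mx B' A1' A0') (X1 *m mpinv W0))
      <-> \rank W0 = (m + 2 * n)%N))
  /\ (\rank W0 = (m + 2 * n)%N -> sys_mx B A1 A0 = X1 *m mpinv W0).
Proof.
move=> X1 W0.
have rankE : \rank W0 = (m + 2 * n)%N <-> row_free W0.
  by rewrite /row_free mul2n -addnn; split=> /eqP.
have identified M : row_free W0 -> recorded h1 h2 T M u x -> M = X1 *m mpinv W0.
  by move=> fW /recordedP; rewrite -/X1 -/W0 => ->;
    rewrite -mulmxA mulmx_mpinv // mulmx1.
split=> [h1_gt0|/rankE fW]; last exact: identified.
split=> [eqv|/rankE fW B' A1' A0' rec]; last by rewrite (identified _ fW rec).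
apply/rankE/inj_row_free => v vW0.
(* [eqv] covers every system that could have produced the data; cutting [M] into blocks makes it
   applicable. *)
have unique M : recorded h1 h2 T M u x -> M = X1 *m mpinv W0.
  rewrite -[M]hsubmxK -[rsubmx M]hsubmxK => /eqv.
  exact: equivalent_trajectories_inj.
(* Every row of [c *m v] is [v], and [n_gt0] provides a row to read. *)
pose c : 'cV[R]_n := const_mx 1.
have : sys_mx B A1 A0 + c *m v = sys_mx B A1 A0.
  rewrite [RHS]unique //; apply: unique; apply/recordedP.
  by rewrite mulmxDl -mulmxA vW0 mulmx0 addr0; apply/recordedP.
move=> /eqP; rewrite -subr_eq0 addrC addKr => /eqP /matrixP cv0.
apply/rowP => j; have := cv0 (Ordinal n_gt0) j.
by rewrite !mxE big_ord1 mxE mul1r.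
Qed.
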